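(* Let $(X,d,\delta)$ be a linear dilatation structure (with group $\Gamma$ and morphism $\nu:\Gamma\to(0,+\infty)$). Then $(X,d,\delta)$ has the Menelaos property: for any two sufficiently closed points $x,y\in X$ and for any $\varepsilon,\mu\in\Gamma$ with $\nu(\varepsilon),\nu(\mu)\in(0,1)$ we have $$\delta^{x}_{\varepsilon}\,\delta^{y}_{\mu}\;=\;\delta^{w}_{\varepsilon\mu},$$ where $w\in X$ is the fixed point of the contraction $\delta^{x}_{\varepsilon}\delta^{y}_{\mu}$ (so $w$ depends on $x,y,\varepsilon,\mu$). The equality of maps is understood locally: $\delta^{x}_{\varepsilon}\delta^{y}_{\mu}z=\delta^{w}_{\varepsilon\mu}z$ for all $z$ such that $x,y,z$ are sufficiently closed.
   Context: **Setting.** $\Gamma$ is a Hausdorff commutative topological group (written multiplicatively, neutral element $1$) with a continuous group morphism $\nu:\Gamma\to(0,+\infty)$ (multiplicative group) such that $\inf\nu(\Gamma)=0$. We write $\varepsilon\to0$ for $\nu(\varepsilon)\to0$. Put $\Gamma_1=\nu^{-1}((0,1])$ and $\bar\Gamma=\Gamma\cup\{0\}$, where neighbourhoods of $0$ are generated by the sets $\nu^{-1}((0,a))\cup\{0\}$, $a>0$. $(X,d)$ is a complete, locally compact metric space; $B_d(x,r)$ and $\bar B_d(x,r)$ are the open and closed balls; $\mathcal V(x)$ is the filter of open neighbourhoods of $x$. **Dilatation structure.** A triple $(X,d,\delta)$ is a dilatation structure if the following axioms A0, A1, A2, A3 hold and, for every $x\in X$, the function $d^x$ of A3 is non-degenerate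 ($d^x(u,v)=0$ implies $u=v$). A0. For every $x\in X$ and $\varepsilon\in\Gamma$ with $\nu(\varepsilon)\le1$ there is a homeomorphism (dilatation) $\delta^x_\varepsilon:U(x)\to V_\varepsilon(x)$, where $U(x),V_\varepsilon(x)$ are open neighbourhoods of $x$. There is a number $A>1$ such that $\bar B_d(x,A)\subset U(x)$ for all $x$, and for all $\varepsilon$ with $\nu(\varepsilon)\in(0,1)$: $B_d(x,\nu(\varepsilon))\subset\delta^x_\varepsilon B_d(x,A)\subset V_\varepsilon(x)\subset U(x)$. There is a number $B>A$ such that for every $\varepsilon$ with $\nu(\varepsilon)>1$ there is a dilatation $\delta^x_\varepsilon:W_\varepsilon(x)\to B_d(x,B)$, injective and invertible on its image, with $W_\varepsilon(x)\in\mathcal V(x)$ and $V_{\varepsilon^{-1}}(x)\subset W_\varepsilon(x)$. For all $\varepsilon\in\Gamma_1$ and $u\in U(x)$: $\delta^x_{\varepsilon^{-1}}\delta^x_\varepsilon u=u$. Moreover, for every compact $K\subset X$ there are $R=R(K)>0$ and $\varepsilon_0=\varepsilon_0(K)\in(0,1)$ such that for all $x\in K$, all $u,v\in\bar B_d(x,R)$ and all $\varepsilon$ with $\nu(\varepsilon)\in(0,\varepsilon_0)$: $\delta^x_\varepsilon v\in W_{\varepsilon^{-1}}(\delta^x_\varepsilon u)$. A1. $\delta^x_\varepsilon x=x$ and $\delta^x_1=\mathrm{id}$ for all $x$. Let $\mathrm{dom}\,\delta$ be the set of $(\varepsilon,x,y)\in\Gamma\times X\times X$ with $y\in U(x)$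 if $\nu(\varepsilon)\le1$ and $y\in W_\varepsilon(x)$ otherwise. The map $(\varepsilon,x,y)\mapsto\delta^x_\varepsilon y$ is continuous on $\mathrm{dom}\,\delta$ and extends continuously to the closure of $\mathrm{dom}\,\delta$ in $\bar\Gamma\times X\times X$, with $\lim_{\varepsilon\to0}\delta^x_\varepsilon y=x$. A2. For all $x\in X$, $\varepsilon,\mu\in\Gamma_1$, $u\in\bar B_d(x,A)$: $\delta^x_\varepsilon\delta^x_\mu u=\delta^x_{\varepsilon\mu}u$. A3. For every $x$ there is a function $(u,v)\mapsto d^x(u,v)$ on $\bar B_d(x,A)\times\bar B_d(x,A)$ such that $$\lim_{\varepsilon\to0}\ \sup\Big\{\Big|\tfrac1{\nu(\varepsilon)}d(\delta^x_\varepsilon u,\delta^x_\varepsilon v)-d^x(u,v)\Big| : u,v\in\bar B_d(x,A)\Big\}=0,$$ uniformly for $x$ in compact sets. **''Sufficiently closed''.** A property $\mathcal P(x_1,x_2,\dots)$ holds for $x_1,x_2,\dots$ sufficiently closed if for every non-empty compact $K\subset X$ there is $C(K)>0$ such that $\mathcal P(x_1,x_2,\dots)$ is true for all $x_1,x_2,\dots\in K$ with $d(x_i,x_j)\le C(K)$ for all $i,j$. **Linear.** A dilatation structure is linear if for any $\varepsilon,\mu\in\Gamma$ with $\nu(\varepsilon),\nu(\mu)\in(0,1]$ and any sufficiently closed $x,y,z\in X$ one has $\delta^x_\varepsilon\,\delta^y_\mu z=\delta^{\delta^x_\varepsilon y}_\mu\,\delta^x_\varepsilon z$ (with $C(K)$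 independent of $\varepsilon,\mu$).
   Formalization: How close the points must be may depend, besides K, on a bound a<1 with ν(ε),ν(μ) ≤ a: with C(K) independent of all ε, μ the claim fails (large circle, Γ=R^*, ε=μ→-1: no fixed point). ''The fixed point'' w is unique in a small closed ball about x. *)

(* Defs.v *)
From HB Require Import structures.
From mathcomp Require Import all_boot all_order all_algebra.
From mathcomp Require Import all_classical all_reals all_analysis.

Set Implicit Arguments.
Unset Strict Implicit.
Unset Printing Implicit Defensive.

Import Order.TTheory GRing.Theory Num.Theory.
Import numFieldNormedType.Exports.

Local Open Scope classical_set_scope.
Local Open Scope ring_scope.

(* The library's [cauchy_cvg], without the base point that [completeType]
   requires. *)
Definition complete_space (X : uniformType) : Prop :=
  forall F : set_system X, ProperFilter F -> cauchy F -> exists l : X, F --> l.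

(* [closed_ball] of the library is the closure of the open ball, which in a
   general metric space can be smaller. *)
Definition cball (R : realType) (X : metricType R) (x : X) (r : R) : set X :=
  [set y | mdist x y <= r].

(* The commutative topological group Gamma is a [topologicalZmodType], hence
   written additively: e + m, - e and 0 stand for the product, the inverse and
   the neutral element.  The target of nu stays multiplicative. *)
Definition scale_morphism (R : realType) (G : topologicalZmodType)
    (nu : G -> R) : Prop :=
  [/\ forall e, 0 < nu e,
      forall e m, nu (e + m) = nu e * nu m,
      continuous nu
    & inf (range nu) = 0].

(* The filter "nu(e) tends to 0" on Gamma. *)
Definition nu_to0 (R : realType) (G : Type) (nu : G -> R) : set_system G :=
  filter_from [set a : R | 0 < a] (fun a => [set e | nu e < a]).

Global Instance nu_to0_filter (R : realType) (G : Type) (nu : G -> R) :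
  Filter (nu_to0 nu).
Proof.
apply: filter_from_filter; first by exists 1 => /=.
move=> a b /= a0 b0; exists (Num.min a b) => /=; first by rewrite lt_min a0.
by move=> e /=; rewrite lt_min => /andP[].
Qed.

(* Gamma together with an additional point [None], the zero of the extended
   group. *)
Definition Gbar (R : realType) (G : topologicalType) (nu : G -> R) : Type :=
  option G.

Section Gbar_topology.
Context (R : realType) (G : topologicalType) (nu : G -> R).

Definition Gbar_open : set_system (Gbar nu) :=
  [set O | open (Some @^-1` O : set G) /\
           (O None -> nu_to0 nu (Some @^-1` O))].

Let Gbar_openT : Gbar_open setT.
Proof. by split=> [|_]; [exact: openT | exact: filterT]. Qed.

Let Gbar_openI : setI_closed Gbar_open.
Proof.
move=> A B [oA A0] [oB B0]; split; first exact: (openI oA oB).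
by move=> [/A0 nA /B0 nB]; exact: (filterI nA nB).
Qed.

Let Gbar_open_bigU (I : Type) (f : I -> set (Gbar nu)) :
  (forall i, Gbar_open (f i)) -> Gbar_open (\bigcup_i f i).
Proof.
move=> fo; split.
  by rewrite preimage_bigcup; apply: bigcup_open => i _; case: (fo i).
move=> [i _ fi0]; have [_ /(_ fi0)] := fo i.
by apply: filterS => e fie; exists i.
Qed.

HB.instance Definition _ := Choice.copy (Gbar nu) (option G).
HB.instance Definition _ :=
  isOpenTopological.Build (Gbar nu) Gbar_openT Gbar_openI Gbar_open_bigU.

Lemma nbhs_GbarS (e : G) (A : set (Gbar nu)) :
  nbhs (Some e : Gbar nu) A <-> nbhs e (Some @^-1` A : set G).
Proof.
split.
  case=> V [[oV _] Ve VA].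
  by apply: (filterS _ (open_nbhs_nbhs (conj oV Ve))) => m /VA.
rewrite nbhsE => -[V [oV Ve] VA].
exists (Some @` V); split; [|by exists e|by move=> _ [m /VA ? <-]].
split; last by case.
suff -> : Some @^-1` (Some @` V) = V by [].
by apply/seteqP; split=> [m [? ? [<-]]|m ?] //; exists m.
Qed.

Lemma nbhs_Gbar0 (A : set (Gbar nu)) : continuous nu ->
  nbhs (None : Gbar nu) A <-> A None /\ nu_to0 nu (Some @^-1` A).
Proof.
move=> cnu; split.
  case=> V [[_ V0] /[dup] VN /V0 nV VA]; split; first exact: VA.
  by apply: filterS nV => e /VA.
case=> AN [a /= a0 aA].
exists [set p : Gbar nu | if p is Some e then nu e < a else True]; split=> //=.
- split; last by move=> _; exists a.
  by apply: (open_comp _ (open_lt (y := a))) => e _; exact: cnu.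
- by case=> [e /aA|].
Qed.

End Gbar_topology.

Definition homeomorphism (X Y : topologicalType) (f : X -> Y)
    (A : set X) (B : set Y) : Prop :=
  [/\ set_bij A B f, {within A, continuous f}
    & exists g : Y -> X,
        {within B, continuous g} /\ (forall u, A u -> g (f u) = u)].

(* A family of partial maps [dil e x] of X.  Its domain is [dilU x] when
   nu e <= 1 and [dilW e x] when nu e > 1; the value of [dil e x] outside this
   domain is irrelevant, as are [dilV e x] for nu e > 1 and [dilW e x] for
   nu e <= 1. *)
Record dilatations (G X : Type) := Dilatations {
  dil : G -> X -> X -> X;
  dilU : X -> set X;
  dilV : G -> X -> set X;
  dilW : G -> X -> set X
}.

Section dilatation_structures.
Context (R : realType) (G : topologicalZmodType) (nu : G -> R).
Context (X : metricType R) (D : dilatations G X).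

Local Notation delta := (dil D).

Definition dil_dom (e : G) (x : X) : set X :=
  if nu e <= 1 then dilU D x else dilW D e x.

(* dom delta, as a subset of Gamma x X x X and of its extension by 0. *)
Definition dom_delta : set (G * X * X) :=
  [set p | dil_dom p.1.1 p.1.2 p.2].

Definition dom_delta_bar : set (Gbar nu * X * X) :=
  [set ((Some p.1.1 : Gbar nu), p.1.2, p.2) | p in dom_delta].

(* The composite of [dil e x] after [dil m y] is defined at z. *)
Definition dil2_dom (e : G) (x : X) (m : G) (y : X) : set X :=
  [set z | dil_dom m y z /\ dil_dom e x (delta m y z)].

Record axiomA0 (A B : R) : Prop := {
  A0_A : 1 < A;
  A0_U : forall x, [/\ open (dilU D x), dilU D x x & cball x A `<=` dilU D x];
  A0_V : forall e x, nu e <= 1 -> open (dilV D e x) /\ dilV D e x x;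
  A0_homeo : forall e x, nu e <= 1 ->
    homeomorphism (delta e x) (dilU D x) (dilV D e x);
  A0_incl : forall e x, nu e < 1 ->
    [/\ ball x (nu e) `<=` delta e x @` ball x A,
        delta e x @` ball x A `<=` dilV D e x
      & dilV D e x `<=` dilU D x];
  A0_B : A < B;
  A0_W : forall e x, 1 < nu e ->
    [/\ open (dilW D e x), dilW D e x x & dilV D (- e) x `<=` dilW D e x];
  A0_Winj : forall e x, 1 < nu e ->
    delta e x @` dilW D e x `<=` ball x B /\ set_inj (dilW D e x) (delta e x);
  A0_inv : forall e x u, nu e <= 1 -> dilU D x u ->
    dil2_dom (- e) x e x u /\ delta (- e) x (delta e x u) = u;
  A0_cpt : forall K : set X, compact K -> exists r e0 : R,
    [/\ 0 < r, 0 < e0 < 1 & forall x u v e, K x -> cball x r u -> cball x r v ->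
        nu e < e0 -> dilW D (- e) (delta e x u) (delta e x v)]
}.

Record axiomA1 : Prop := {
  A1_fix : forall e x, delta e x x = x;
  A1_id : forall x u, dil_dom 0 x u -> delta 0 x u = u;
  A1_cont : {within dom_delta, continuous (fun p => delta p.1.1 p.1.2 p.2)};
  A1_ext : exists F : Gbar nu * X * X -> X,
    {within closure dom_delta_bar, continuous F} /\
    forall e x y, dil_dom e x y -> F ((Some e : Gbar nu), x, y) = delta e x y;
  A1_lim : forall x y, dilU D x y ->
    (fun e => delta e x y) @ nu_to0 nu --> x
}.

Definition axiomA2 (A : R) : Prop :=
  forall x e m u, nu e <= 1 -> nu m <= 1 -> cball x A u ->
    dil2_dom e x m x u /\ delta e x (delta m x u) = delta (e + m) x u.

(* [dx x u v] is d^x(u, v); only its values for u, v in the closed ball of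
   center x and radius A matter. *)
Definition axiomA3 (A : R) (dx : X -> X -> X -> R) : Prop :=
  forall K : set X, compact K -> forall eta : R, 0 < eta ->
    \forall e \near nu_to0 nu, forall x u v,
      K x -> cball x A u -> cball x A v ->
      `| (nu e)^-1 * mdist (delta e x u) (delta e x v) - dx x u v | <= eta.

Definition nondegenerate (A : R) (dx : X -> X -> X -> R) : Prop :=
  forall x u v, cball x A u -> cball x A v -> dx x u v = 0 -> u = v.

Definition dilatation_structure : Prop :=
  exists A B : R, [/\ axiomA0 A B, axiomA1, axiomA2 A
    & exists dx, axiomA3 A dx /\ nondegenerate A dx].

(* The points of [s] are in K and at mutual distance at most C: a property
   holds for x, y, ... sufficiently closed when for each non-empty compact K
   there is C > 0 such that [close_points K C [:: x; y; ...]] implies it. *)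
Definition close_points (K : set X) (C : R) (s : seq X) : Prop :=
  {in s, forall p, K p} /\ {in s &, forall p q, mdist p q <= C}.

Definition linear_dilatations : Prop :=
  forall K : set X, compact K -> K !=set0 -> exists2 C : R, 0 < C &
    forall x y z, close_points K C [:: x; y; z] ->
    forall e m, nu e <= 1 -> nu m <= 1 ->
    [/\ dil2_dom e x m y z, dil_dom e x y,
        dil2_dom m (delta e x y) e x z
      & delta e x (delta m y z) = delta m (delta e x y) (delta e x z)].

Definition dil2_fixed (e : G) (x : X) (m : G) (y : X) (w : X) : Prop :=
  dil2_dom e x m y w /\ delta e x (delta m y w) = w.

(* C is uniform in e and m as long as nu e, nu m <= a < 1.  It cannot be uniform
   over all nu e, nu m < 1: for Gamma = R^*, nu = |.| and the usual dilatations
   of a line, the fixed point for m = e satisfies w - y = (x - y) / (1 + e),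
   which is unbounded as e tends to -1; on a large circle, where the dilatations
   are only local, the composite then has no fixed point at all.
   Dilatations being local, "the" fixed point means the only one in a closed
   ball around x. *)
Definition menelaos : Prop :=
  forall a : R, a < 1 ->
  forall K : set X, compact K -> K !=set0 ->
  exists C r : R, [/\ 0 < C, 0 < r &
    forall x y, close_points K C [:: x; y] ->
    forall e m, nu e <= a -> nu m <= a ->
    exists w, [/\ cball x r w, dil2_fixed e x m y w,
      forall w', cball x r w' -> dil2_fixed e x m y w' -> w' = w
      & forall z, close_points K C [:: x; y; z] ->
          [/\ dil2_dom e x m y z, dil_dom (e + m) w z
            & delta e x (delta m y z) = delta (e + m) w z]]].

End dilatation_structures.

(* Main.v *)
(* Let f = delta^x_e delta^y_m.  Applying linearity twice gives
   f = delta^(f x)_e delta^(f y)_m, hence f = delta^(x_n)_e delta^(y_n)_m for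
   x_n = f^n x and y_n = f^n y.  The dilatations need not be contractions of d,
   but near x each delta^p_e multiplies the tangent metric d^x by exactly nu(e):
   at the scale l around x this is A3 applied at the moving center delta^x_l p.
   So f preserves a small d^x-ball around x, and d^x(x_n, y_n) and
   d^x(x_n, x_(n+1)) tend to 0.  By compactness (x_n, y_n) accumulates at some
   (w, w'), non-degeneracy of d^x gives w = w' and f w = w, and the limit of
   f = delta^(x_n)_e delta^(y_n)_m is f = delta^w_e delta^w_m = delta^w_(em).
   Exact scaling of d^x also makes the fixed point unique. *)
Require Import Defs.
From mathcomp Require Import all_boot all_order all_algebra.
From mathcomp Require Import all_classical all_reals all_analysis.
From mathcomp Require Import lra.

Set Implicit Arguments.
Unset Strict Implicit.
Unset Printing Implicit Defensive.

Import Order.TTheory GRing.Theory Num.Theory.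
Import numFieldNormedType.Exports.

Local Open Scope classical_set_scope.
Local Open Scope ring_scope.

(** * Metric spaces and compact neighbourhoods of compact sets *)

Section metric_spaces.
Context (R : realType) (X : metricType R).

Lemma mdistC (x y : X) : mdist x y = mdist y x.
Proof. exact: metric_sym. Qed.

Lemma mdistD (y x z : X) : mdist x z <= mdist x y + mdist y z.
Proof. exact: metric_triangle. Qed.

Lemma in_ball (x y : X) (r : R) : ball x r y = (mdist x y < r) :> Prop.
Proof. by rewrite ballEmdist. Qed.

Lemma cball_center (x : X) (r : R) : 0 <= r -> cball x r x.
Proof. by rewrite /cball/= mdistxx. Qed.

Lemma cball_le (x : X) (r s : R) : r <= s -> cball x r `<=` cball x s.
Proof. by move=> rs y /= /le_trans; apply. Qed.

Lemma mdist_cball2 (x p q : X) (r : R) :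
  cball x r p -> cball x r q -> mdist p q <= 2 * r.
Proof.
rewrite /cball/= => xp xq; have := mdistD x p q.
by rewrite (mdistC p x); lra.
Qed.

(** Finitely many compact neighbourhoods cover [K]. The filter [F] of pairs (radius, set), with
    shrinking radii and growing sets, hides the finite subcover: its intersections take a minimum of
    radii and a union of compact sets. *)
Lemma compact_cball_nbhs (K : set X) : locally_compact [set: X] -> compact K ->
  exists r : R, exists2 K', 0 < r /\ compact K' &
    forall x, K x -> cball x r `<=` K'.
Proof.
move=> lcX /compact_near_coveringP cK.
pose F : set_system (R * set X) :=
  filter_from [set i | 0 < i.1 /\ compact i.2]
    (fun i => [set j | j.1 <= i.1 /\ i.2 `<=` j.2]).
have FF : Filter F.
  apply: filter_from_filter.
    by exists (1, set0); split=> //; exact: compact0.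
  move=> [r U] [s V] /= [r0 cU] [s0 cV]; exists (Num.min r s, U `|` V) => /=.
    by rewrite lt_min r0 s0; split=> //; exact: compactU.
  move=> [t W] /= []; rewrite le_min => /andP[tr ts] UVW.
  by split; split=> // x ?; apply: UVW; [left|right].
have [|[r U] /= [r0 cU] h] := cK _ F (fun i x => ball x i.1 `<=` i.2) FF.
  move=> x Kx; have [U xU [cU _]] := lcX x Logic.I.
  have /nbhs_ballP[e /= e0 eU] : nbhs x U.
    by move: xU; rewrite /within /=; apply: filterS => y; apply.
  exists (ball x (e / 2), [set j | j.1 <= e / 2 /\ U `<=` j.2]).
    split; first by apply: nbhsx_ballx; lra.
    by exists (e / 2, U) => //; split=> //=; lra.
  move=> [y [s V]] /= [xy [se UV]] z yz; apply: UV; apply: eU.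
  by apply: (le_ball _ (ball_triangle xy yz)); lra.
exists (r / 2), U; first by split=> //; lra.
move=> x Kx y xy; apply: (h (r, U) _ x Kx); first by split.
by rewrite in_ball; move: xy; rewrite /cball /=; lra.
Qed.

End metric_spaces.

(** * The scale morphism *)

Section scale_morphisms.
Context (R : realType) (G : topologicalZmodType) (nu : G -> R).
Context (hnu : scale_morphism nu).

Lemma nu_gt0 e : 0 < nu e.
Proof. by case: hnu. Qed.

Lemma nuD e m : nu (e + m) = nu e * nu m.
Proof. by case: hnu. Qed.

Lemma nu0 : nu 0 = 1.
Proof.
have := nuD 0 0; rewrite addr0 => /eqP.
by rewrite -subr_eq0 -{1}[nu 0]mulr1 -mulrBr mulf_eq0 gt_eqF ?nu_gt0//=
  subr_eq0 => /eqP.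
Qed.

Lemma nuN e : nu (- e) = (nu e)^-1.
Proof.
apply: (mulfI (lt0r_neq0 (nu_gt0 e))).
by rewrite -nuD subrr nu0 divff// gt_eqF// nu_gt0.
Qed.

Lemma ex_nu_lt (a : R) : 0 < a -> exists e, nu e < a.
Proof.
case: hnu => _ _ _ nu_inf a0; have : inf (range nu) < a by rewrite nu_inf.
by case/inf_lt => [|_ [e _ <-] ea]; [exists (nu 0), 0 | exists e].
Qed.

Lemma ex_nu_gt (a : R) : exists e, a < nu e.
Proof.
have a0 : 0 < `|a| + 1 by rewrite ltr_wpDl.
have [e ea] : exists e, nu e < (`|a| + 1)^-1.
  by apply: ex_nu_lt; rewrite invr_gt0.
exists (- e); rewrite nuN; apply: (@lt_trans _ _ (`|a| + 1)).
  by rewrite ltr_pwDr// ler_norm.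
by rewrite -[_ + 1]invrK ltf_pV2// posrE ?invr_gt0// nu_gt0.
Qed.

End scale_morphisms.

(** * Real estimates and sequences *)

Lemma ratio_estimate (R : realType) (c d y eta : R) : 0 < c ->
  `|c^-1 * d - y| <= eta -> `|d - c * y| <= c * eta.
Proof.
move=> c0 h; have -> : d - c * y = c * (c^-1 * d - y).
  by rewrite mulrBr mulVKf// gt_eqF.
by rewrite normrM (gtr0_norm c0) ler_pM2l.
Qed.

(** Numerical core of [dx_scale]: the first two bounds put [d1] close to [e * d0], and the last two
    turn this into [y1] close to [e * y0]. Every error is at most a multiple of [l * eta], so [l]
    cancels. *)
Lemma scale_estimate (R : realType) (e l s d0 d1 y y0 y1 eta : R) :
  0 < e <= 1 -> 0 < l -> 0 < s -> 0 < eta ->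
  `|(l * s)^-1 * d0 - y| <= eta -> `|(e * (l * s))^-1 * d1 - y| <= eta ->
  `|l^-1 * d0 - y0| <= eta -> `|l^-1 * d1 - y1| <= eta ->
  `|y1 - e * y0| <= (2 * s + 2) * eta.
Proof.
move=> /andP[e0 e1] l0 s0 eta0.
have ls0 : 0 < l * s by exact: mulr_gt0.
move=> /(ratio_estimate ls0) h0 /(ratio_estimate (mulr_gt0 e0 ls0)) h1.
move=> /(ratio_estimate l0) h2 /(ratio_estimate l0) h3.
have h0' : `|e * d0 - e * (l * s) * y| <= l * s * eta.
  rewrite -mulrA -mulrBr normrM (gtr0_norm e0) -[leRHS]mul1r.
  by apply: ler_pM => //; exact: ltW.
have h1' : `|d1 - e * (l * s) * y| <= l * s * eta.
  apply: le_trans h1 _; rewrite -(mulrA e) ler_piMl//.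
  by rewrite mulr_ge0// ltW.
have h2' : `|e * d0 - l * (e * y0)| <= l * eta.
  rewrite mulrCA -mulrBr normrM (gtr0_norm e0) -[leRHS]mul1r.
  by apply: ler_pM => //; exact: ltW.
rewrite -(ler_pM2l l0) -{1}(gtr0_norm l0) -normrM mulrBr.
have -> : l * ((2 * s + 2) * eta) = 2 * (l * s * eta) + 2 * (l * eta) by lra.
move: h0' h1' h2' h3 => /ler_normlP[? ?] /ler_normlP[? ?] /ler_normlP[? ?].
by move=> /ler_normlP[? ?]; apply/ler_normlP; split; lra.
Qed.

(** Clustering in the product space makes one index [n] serve both sequences. *)
Lemma compact_accumulation2 (R : realType) (X : metricType R) (K : set X)
    (u v : nat -> X) :
  compact K -> (forall n, K (u n)) -> (forall n, K (v n)) ->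
  exists w w', forall (eta : R) N, 0 < eta -> exists2 n, (N <= n)%N &
    mdist w (u n) < eta /\ mdist w' (v n) < eta.
Proof.
move=> cK Ku Kv.
have FK : ((fun n => (u n, v n)) @ \oo) (K `*` K).
  by exists 0%N => // n _; split; [exact: Ku | exact: Kv].
have [[w w'] [_ ww']] := compact_setX cK cK (fmap_proper_filter _ _) FK.
exists w, w' => eta N eta0.
have FN : ((fun n => (u n, v n)) @ \oo)
    [set p | exists2 n, (N <= n)%N & p = (u n, v n)].
  by exists N => // n /= Nn; exists n.
have nww' : nbhs (w, w') (ball w eta `*` ball w' eta).
  by exists (ball w eta, ball w' eta) => //; split; exact: nbhsx_ballx.
have [_ [[n Nn ->] [/= wu wv]]] := ww' _ _ FN nww'.
by exists n => //; rewrite -!in_ball.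
Qed.

Lemma geometric_lt (R : realType) (q c eta : R) : 0 <= q < 1 -> 0 < eta ->
  exists N, forall n, (N <= n)%N -> q ^+ n * c < eta.
Proof.
move=> /andP[q0 q1] eta0.
have c0 : 0 < `|c| + 1 by rewrite ltr_wpDl.
have /cvgrPdist_lt/(_ _ (divr_gt0 eta0 c0)) :
    (GRing.exp q : nat -> R) @ \oo --> (0 : R).
  by apply: cvg_expr; rewrite ger0_norm.
case=> N _ h; exists N => n /h /=; rewrite sub0r normrN ger0_norm ?exprn_ge0//.
rewrite ltr_pdivlMr//; apply: le_lt_trans; rewrite ler_wpM2l ?exprn_ge0//.
by apply: le_trans (ler_norm c) _; rewrite lerDl.
Qed.

(** * Dilatations under the axioms A0 to A3 *)

Section dilatation_structure.
Context (R : realType) (G : topologicalZmodType) (nu : G -> R).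
Context (X : metricType R) (D : dilatations G X) (A B : R).
Context (hnu : scale_morphism nu) (hA0 : axiomA0 nu D A B) (hA1 : axiomA1 nu D).
Context (hA2 : axiomA2 nu D A).
Context (dx : X -> X -> X -> R) (hA3 : axiomA3 nu D A dx).

Local Notation del := (dil D).

Let nu_gt0 := nu_gt0 hnu.
Let nuD := nuD hnu.

Lemma radius_gt1 : 1 < A.
Proof. by case: hA0. Qed.

Lemma cball_dilU x : cball x A `<=` dilU D x.
Proof. by have [_ _] := A0_U hA0 x. Qed.

Lemma dil_dom_small e x : nu e <= 1 -> dil_dom nu D e x = dilU D x.
Proof. by rewrite /dil_dom => ->. Qed.

Lemma dilD e m x u : nu e <= 1 -> nu m <= 1 -> cball x A u ->
  del e x (del m x u) = del (e + m) x u.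
Proof. by move=> e1 m1 xu; case: (hA2 e1 m1 xu). Qed.

(** Taken from the domain clause of A2, with the neutral element as outer scale. *)
Lemma dil_in_dilU e x u : nu e <= 1 -> cball x A u -> dilU D x (del e x u).
Proof.
move=> e1 xu; have n1 : nu 0 <= 1 by rewrite nu0.
by have [[_]] := hA2 n1 e1 xu; rewrite dil_dom_small.
Qed.

Lemma dil_inj e x u v : nu e <= 1 -> dilU D x u -> dilU D x v ->
  del e x u = del e x v -> u = v.
Proof.
move=> e1 xu xv uv.
by rewrite -(A0_inv hA0 e1 xu).2 uv (A0_inv hA0 e1 xv).2.
Qed.

(** The inverse dilatation, of scale above 1, takes values in the ball of radius [B], and [u] is one
    of them. *)
Lemma dilU_bounded x u : dilU D x u -> mdist x u < B.
Proof.
move=> xu; have [e e1] := ex_nu_lt hnu ltr01.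
have Ne1 : 1 < nu (- e) by rewrite nuN// invf_gt1.
have [[_ +] <-] := A0_inv hA0 (ltW e1) xu.
rewrite /dil_dom leNgt Ne1/= => W.
have [+ _] := A0_Winj hA0 x Ne1.
by move/(_ _ (imageP _ W)); rewrite in_ball.
Qed.

Lemma dil_surj e x u : nu e < 1 -> mdist x u < nu e ->
  exists2 v, cball x A v & del e x v = u.
Proof.
move=> e1 xu; have [+ _ _] := A0_incl hA0 x e1; case/(_ u).
  by rewrite in_ball.
by move=> v; rewrite in_ball => /ltW xv vu; exists v.
Qed.

Lemma A3_approx (K : set X) (eta : R) : compact K -> 0 < eta ->
  exists2 a : R, 0 < a & forall e, nu e < a -> forall x u v,
    K x -> cball x A u -> cball x A v ->
    `|(nu e)^-1 * mdist (del e x u) (del e x v) - dx x u v| <= eta.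
Proof. by move=> cK eta0; have [a a0 h] := hA3 cK eta0; exists a. Qed.

(** By A3 the ratio of [mdist x (del e x u)] to [nu e] is within 1 of [dx x x u]; at one fixed scale
    [l] the same comparison bounds [dx x x u] by [B / nu l + 1]. Hence the value of [M]. *)
Lemma dil_linear_bound (K : set X) : compact K -> exists M a : R,
  [/\ 0 < M, 0 < a & forall e x u, nu e < a -> K x -> cball x A u ->
    mdist x (del e x u) <= M * nu e].
Proof.
move=> cK; have [a a0 h] := A3_approx cK ltr01.
have [l la] : exists l, nu l < Num.min 1 a.
  by apply: ex_nu_lt => //; rewrite lt_min a0 ltr01.
move: la; rewrite lt_min => /andP[l1 la].
have B0 : 0 < B.
  by have := A0_B hA0; have := radius_gt1; lra.
exists (B / nu l + 2), a; split=> //.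
  by have := divr_gt0 B0 (nu_gt0 l); lra.
move=> e x u ea Kx xu.
have xx : cball x A x by apply: cball_center; have := radius_gt1; lra.
have := h e ea _ _ _ Kx xx xu; have := h l la _ _ _ Kx xx xu.
rewrite !(A1_fix hA1) => /ler_normlP[hl _] /ler_normlP[_ he].
have : (nu l)^-1 * mdist x (del l x u) <= B / nu l.
  rewrite mulrC ler_pM2r ?invr_gt0//; apply/ltW/dilU_bounded.
  by apply: dil_in_dilU => //; exact: ltW.
by move=> hB; rewrite -ler_pdivrMr// mulrC; lra.
Qed.

Lemma dil_near e x y (eta : R) : dil_dom nu D e x y -> 0 < eta ->
  exists2 t : R, 0 < t & forall x' y', mdist x x' < t -> mdist y y' < t ->
    dil_dom nu D e x' y' -> mdist (del e x y) (del e x' y') < eta.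
Proof.
move=> exy eta0.
have /subspace_continuousP/(_ (e, x, y) exy) := A1_cont hA1.
move=> /(_ _ (nbhsx_ballx (del e x y) eta eta0)).
case=> -[N V] /= [[[N1 N2] /= [N1e N2x] N12] Vy] NV.
have /nbhs_ballP[a /= a0 aN] := N2x.
have /nbhs_ballP[b /= b0 bV] := Vy.
exists (Num.min a b); first by rewrite lt_min a0.
move=> x' y'; rewrite !lt_min => /andP[xa _] /andP[_ yb] dom.
rewrite -in_ball; apply: (NV (e, x', y')) => //; split=> /=.
  apply: N12; split=> /=; first exact: nbhs_singleton.
  by apply: aN; rewrite in_ball.
by apply: bV; rewrite in_ball.
Qed.

(** A3 controls small scales only, whereas here [nu e <= 1] is arbitrary. Writing [u] as [del k x v]
    turns [del e x u] into [del (e + k) x v], whose scale is small. *)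
Lemma dil_stable (K : set X) (eta : R) : compact K -> 0 < eta ->
  exists2 t : R, 0 < t & forall e x u, nu e <= 1 -> K x -> mdist x u < t ->
    mdist x (del e x u) <= eta.
Proof.
move=> cK eta0; have [M [a [M0 a0 h]]] := dil_linear_bound cK.
have [k] : exists k, nu k < Num.min 1 (Num.min a (eta / M)).
  by apply: ex_nu_lt => //; rewrite !lt_min ltr01 a0 divr_gt0.
rewrite !lt_min => /and3P[k1 ka kM].
exists (nu k) => // e x u e1 Kx xu.
have [v xv <-] := dil_surj k1 xu.
have ek : nu (e + k) <= nu k by rewrite nuD ler_piMl// ltW.
rewrite (dilD e1 (ltW k1) xv); apply: (@le_trans _ _ (M * nu (e + k))).
  by apply: h => //; exact: le_lt_trans ka.
by rewrite mulrC -ler_pdivlMr//; apply: le_trans (ltW kM).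
Qed.

(** * The tangent metric d^x *)

(** Replaces limits in the scale: the properties of [dx x] below are read off from one scale [l], up
    to an arbitrary error. *)
Lemma dx_approx x (eta b : R) : 0 < eta -> 0 < b -> exists2 l, nu l < b &
  forall u v, cball x A u -> cball x A v ->
    `|(nu l)^-1 * mdist (del l x u) (del l x v) - dx x u v| <= eta.
Proof.
move=> eta0 b0; have [a a0 h] := A3_approx (@compact_set1 _ x) eta0.
have [l] : exists l, nu l < Num.min a b.
  by apply: ex_nu_lt => //; rewrite lt_min a0.
by rewrite lt_min => /andP[la lb]; exists l => // u v; apply: h.
Qed.

Lemma cball_self (x : X) : cball x A x.
Proof. by apply: cball_center; have := radius_gt1; lra. Qed.

Lemma dx_ge0 x u v : cball x A u -> cball x A v -> 0 <= dx x u v.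
Proof.
move=> xu xv; apply/ler_addgt0Pr => eta eta0.
have [l _ /(_ u v xu xv)] := dx_approx x eta0 ltr01.
have : 0 <= (nu l)^-1 * mdist (del l x u) (del l x v).
  by rewrite mulr_ge0 ?mdist_ge0// invr_ge0 ltW.
by move=> ? /ler_normlP[]; lra.
Qed.

Lemma dxC x u v : cball x A u -> cball x A v -> dx x u v = dx x v u.
Proof.
suff le u' v' : cball x A u' -> cball x A v' -> dx x u' v' <= dx x v' u'.
  by move=> xu xv; apply/eqP; rewrite eq_le !le.
move=> xu xv; apply/ler_addgt0Pr => eta eta0.
have eta2 : 0 < eta / 2 by lra.
have [l _ h] := dx_approx x eta2 ltr01.
have := h _ _ xu xv; have := h _ _ xv xu; rewrite mdistC.
by move=> /ler_normlP[? ?] /ler_normlP[? ?]; lra.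
Qed.

Lemma dx_triangle x v u w : cball x A u -> cball x A v -> cball x A w ->
  dx x u w <= dx x u v + dx x v w.
Proof.
move=> xu xv xw; apply/ler_addgt0Pr => eta eta0.
have eta3 : 0 < eta / 3 by lra.
have [l _ h] := dx_approx x eta3 ltr01.
have := h _ _ xu xw; have := h _ _ xv xw; have := h _ _ xu xv.
have : (nu l)^-1 * mdist (del l x u) (del l x w) <=
    (nu l)^-1 * mdist (del l x u) (del l x v) +
    (nu l)^-1 * mdist (del l x v) (del l x w).
  by rewrite -mulrDr ler_pM2l ?invr_gt0// mdistD.
by move=> ? /ler_normlP[? ?] /ler_normlP[? ?] /ler_normlP[? ?]; lra.
Qed.

Lemma dx_cont x u (eta : R) : cball x A u -> 0 < eta ->
  exists2 t : R, 0 < t & forall v, cball x A v -> mdist u v < t ->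
    dx x u v <= eta.
Proof.
move=> xu eta0; have eta2 : 0 < eta / 2 by lra.
have [l l1 h] := dx_approx x eta2 ltr01.
have dom v : cball x A v -> dil_dom nu D l x v.
  by move=> /cball_dilU; rewrite dil_dom_small// ltW.
(* The scale [l] is frozen, so continuity of [del l x] to within [nu l * (eta / 2)] suffices. *)
have [t t0 ht] := dil_near (dom _ xu) (mulr_gt0 (nu_gt0 l) eta2).
exists t => // v xv uv.
have := ht x v; rewrite mdistxx => /(_ t0 uv (dom _ xv)).
rewrite mulrC -ltr_pdivrMr// mulrC => lt2.
by have /ler_normlP[] := h _ _ xu xv; lra.
Qed.

(** Unlike in [dx_cont], the radius is uniform over [K], although the scale [l] depends on [x]: with
    [u = del k x v], the distance from [x] to [del l x u] is at most [M * nu l * nu k], and [nu l]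
    cancels. *)
Lemma dx_small (K : set X) (eta : R) : compact K -> 0 < eta ->
  exists2 t : R, 0 < t & forall x u, K x -> cball x A u -> mdist x u < t ->
    dx x x u <= eta.
Proof.
move=> cK eta0; have [M [a [M0 a0 h]]] := dil_linear_bound cK.
have eta2 : 0 < eta / 2 by lra.
have [k] : exists k, nu k < Num.min 1 (Num.min a (eta / 2 / M)).
  by apply: ex_nu_lt => //; rewrite !lt_min ltr01 a0 divr_gt0.
rewrite !lt_min => /and3P[k1 ka kM].
exists (nu k) => // x u Kx xu /(dil_surj k1)[v xv vu].
have [l l1 /(_ _ _ (cball_self x) xu)] := dx_approx x eta2 ltr01.
rewrite (A1_fix hA1) -{1}vu (dilD (ltW l1) (ltW k1) xv).
have lk : nu (l + k) < a.
  by rewrite nuD (le_lt_trans _ ka)// ler_piMl// ltW.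
have := h _ _ _ lk Kx xv; rewrite nuD mulrCA -ler_pdivrMl// => h1.
have : M * nu k <= eta / 2 by rewrite mulrC -ler_pdivlMr// ltW.
by move=> ? /ler_normlP[]; lra.
Qed.

(** If [dx x x u < nu k], then at a fine scale [l] the point [del l x u] is within [nu (l + k)] of
    [x], hence equals [del l x (del k x v)] for some [v]; injectivity gives [u = del k x v], which
    is close to [x]. *)
Lemma mdist_small (K : set X) (r : R) : compact K -> 0 < r ->
  exists2 t : R, 0 < t & forall x u, K x -> cball x A u -> dx x x u < t ->
    mdist x u <= r.
Proof.
move=> cK r0; have [M [a [M0 a0 h]]] := dil_linear_bound cK.
have [k] : exists k, nu k < Num.min 1 (Num.min a (r / M)).
  by apply: ex_nu_lt => //; rewrite !lt_min ltr01 a0 divr_gt0.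
rewrite !lt_min => /and3P[k1 ka kM].
exists (nu k) => // x u Kx xu xuk.
have gap : 0 < (nu k - dx x x u) / 2 by lra.
have [l l1 /(_ _ _ (cball_self x) xu)] := dx_approx x gap ltr01.
rewrite (A1_fix hA1) => /ler_normlP[_ hl].
have : mdist x (del l x u) < nu (l + k).
  by rewrite nuD -ltr_pdivrMl//; lra.
have lk1 : nu (l + k) < 1.
  by rewrite nuD mulr_ilt1// ltW.
move=> /(dil_surj lk1)[v xv]; rewrite -(dilD (ltW l1) (ltW k1) xv) => /dil_inj.
move=> /(_ (ltW l1) (dil_in_dilU (ltW k1) xv) (cball_dilU xu)) <-.
apply: le_trans (h _ _ _ ka Kx xv) _.
by rewrite mulrC -ler_pdivlMr// ltW.
Qed.

(** * Linearity and exact scaling of d^x *)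

Context (lcX : locally_compact [set: X]) (hlin : linear_dilatations nu D).

(** The centers used later drift off [K], so linearity is taken on a compact neighbourhood [K'] of
    [K]; the radius [C / 2] keeps mutual distances at most [C]. *)
Lemma linear_near (K : set X) : compact K -> K !=set0 ->
  exists2 r : R, 0 < r & forall x p q z e m, K x ->
    cball x r p -> cball x r q -> cball x r z -> nu e <= 1 -> nu m <= 1 ->
    dil2_dom nu D e p m q z /\
    del e p (del m q z) = del m (del e p q) (del e p z).
Proof.
move=> cK [x0 Kx0]; have [r [K' [r0 cK'] KK']] := compact_cball_nbhs lcX cK.
have K'0 : K' !=set0.
  by exists x0; apply: (KK' x0 Kx0); exact/cball_center/ltW.
have [C C0 hC] := hlin cK' K'0.
exists (Num.min r (C / 2)); first by rewrite lt_min r0; lra.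
move=> x p q z e m Kx xp xq xz e1 m1.
have inK' y : cball x (Num.min r (C / 2)) y -> K' y.
  by move=> xy; apply: (KK' x Kx); apply: cball_le xy; rewrite ge_min lexx.
have close y y' : cball x (Num.min r (C / 2)) y ->
    cball x (Num.min r (C / 2)) y' -> mdist y y' <= C.
  have : Num.min r (C / 2) <= C / 2 by rewrite ge_min lexx orbT.
  by move=> ? /mdist_cball2 h /h; lra.
have [|? _ ?] := hC p q z _ e m e1 m1; last by [].
split=> [y|y y']; rewrite !inE.
  by case/or3P => /eqP ->; exact: inK'.
by move=> /or3P[] /eqP -> /or3P[] /eqP ->; exact: close.
Qed.

(* Seen from [x] at the scale [l], the points [p], [u] and [v] lie within
   [O(nu l)] of each other, so that A3 at the center [del l x p] controls both
   [u], [v] and their images under [del e p]. *)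
Lemma dx_scale (K : set X) : compact K -> K !=set0 ->
  exists2 r : R, 0 < r & forall x p u v e, K x ->
    cball x r p -> cball x r u -> cball x r v -> nu e <= 1 ->
    cball x A (del e p u) /\
    dx x (del e p u) (del e p v) = nu e * dx x u v.
Proof.
move=> cK K0; have [r1 [K' [r10 cK'] KK']] := compact_cball_nbhs lcX cK.
have [r2 r20 lin] := linear_near cK K0.
have half0 : 0 < 2^-1 :> R by lra.
have [t t0 stab] := dil_stable cK' half0.
have [M [a [M0 a0 shr]]] := dil_linear_bound cK'.
(* [t / 4] puts [p] and [u] within [t] of each other, so [del e p u] is within 1/2 of [p]; with
   [r <= 2^-1] it is within [1 < A] of [x]. *)
pose r := Num.min 2^-1 (Num.min r1 (Num.min r2 (t / 4))).
have [rh rr1 rr2 rt] : [/\ r <= 2^-1, r <= r1, r <= r2 & r <= t / 4].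
  by rewrite /r; split; rewrite !ge_min lexx ?orbT.
exists r; first by rewrite !lt_min half0 r10 r20; lra.
have A1 := radius_gt1.
have inA x p u e : K x -> cball x r p -> cball x r u -> nu e <= 1 ->
    cball x A (del e p u).
  move=> Kx xp xu e1; have := mdist_cball2 xp xu => pu.
  have pt : mdist p u < t by lra.
  have := stab e p u e1 (KK' x Kx p (cball_le rr1 xp)) pt.
  by move: xp; rewrite /cball/=; have := mdistD p x (del e p u); lra.
move=> x p u v e Kx xp xu xv e1; split; first exact: inA.
have K'x : K' x by apply: (KK' x Kx); apply: cball_center; lra.
have rA : r <= A by lra.
(* At the scale [l] the points lie within [2 * M * nu l] of [P]; this [s] makes that less than
   [nu (l + s)], so that they are values of [del (l + s) P]. *)
have [s sM] := ex_nu_gt hnu (2 * M).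
apply/eqP; rewrite -subr_eq0 -normr_le0; apply/ler_addgt0Pr => c c0.
rewrite add0r; have S0 : 0 < 2 * nu s + 2 by have := nu_gt0 s; lra.
pose eta := c / (2 * nu s + 2).
have etap : 0 < eta by rewrite divr_gt0.
have -> : c = (2 * nu s + 2) * eta by rewrite mulrC divfK// gt_eqF.
have [a1 a10 hA] := A3_approx cK' etap.
(* In order: [dil_linear_bound] applies at [l], [P] stays in [K'], and A3 and A2 apply around [P] at
   the scale [l + s]. *)
have [||l] := @dx_approx x eta
  (Num.min (Num.min 1 a) (Num.min (r1 / M) (Num.min a1 1 / nu s))) => //.
  by rewrite !lt_min ltr01 a0 !divr_gt0// lt_min a10 ltr01.
rewrite !lt_min ltr_pdivlMr// ltr_pdivlMr// lt_min.
move=> /andP[/andP[l1 la] /andP[lr1 /andP[lsa ls1]]] hl.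
rewrite -!nuD in lsa ls1.
pose P := del l x p.
have xP w : cball x r w -> mdist x (del l x w) <= M * nu l.
  by move=> xw; apply: shr => //; exact: cball_le xw.
have K'P : K' P.
  by apply: (KK' x Kx); rewrite /cball/=; have := xP p xp; lra.
have blow w : cball x r w ->
    exists2 w', cball P A w' & del (l + s) P w' = del l x w.
  move=> xw; apply: dil_surj => //; rewrite nuD mulrC.
  have : 2 * M * nu l < nu s * nu l by rewrite ltr_pM2r.
  have := mdistD x P (del l x w); rewrite (mdistC P x).
  by have := xP p xp; have := xP w xw; rewrite /P; lra.
have shift w : cball x r w -> exists2 w', cball P A w' &
    del (l + s) P w' = del l x w /\
    del (e + (l + s)) P w' = del l x (del e p w).
  move=> xw; have [w' Pw' w'w] := blow w xw; exists w' => //; split=> //.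
  rewrite -(dilD e1 (ltW ls1) Pw') w'w.
  have x2 y : cball x r y -> cball x r2 y by exact: cball_le.
  have xx : cball x r2 x by apply: cball_center; lra.
  (* Dilating by [e] around [p], then by [l] around [x], amounts to dilating by [l] around [x], then
     by [e] around [P]. *)
  by have [_ ->] := lin x x p w l e Kx xx (x2 _ xp) (x2 _ xw) (ltW l1) e1.
have [u' Pu' [uu' eu']] := shift u xu; have [v' Pv' [vv' ev']] := shift v xv.
have ea : nu (e + (l + s)) < a1.
  by rewrite nuD (le_lt_trans _ lsa)// ler_piMl// ltW.
have h0 := hA _ lsa _ _ _ K'P Pu' Pv'; have h1 := hA _ ea _ _ _ K'P Pu' Pv'.
have h2 := hl _ _ (cball_le rA xu) (cball_le rA xv).
have h3 := hl _ _ (inA _ _ _ _ Kx xp xu e1) (inA _ _ _ _ Kx xp xv e1).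
rewrite uu' vv' in h0; rewrite eu' ev' in h1; rewrite !nuD in h0 h1.
by apply: scale_estimate h0 h1 h2 h3 => //; rewrite nu_gt0.
Qed.

(** * Iteration of the composite and its fixed point *)

Context (hdx : Defs.nondegenerate A dx).

Lemma linear_menelaos : menelaos nu D.
Proof.
move=> a a1 K cK K0.
have [r1 [K' [r10 cK'] KK']] := compact_cball_nbhs lcX cK.
have [rl rl0 lin] := linear_near cK K0.
have [rs rs0 scale] := dx_scale cK K0.
have rs2 : 0 < rs / 2 by lra.
have [t t0 stab] := dil_stable cK' rs2.
(* For [u] in the [r]-ball, [rs / 2] and [t / 4] keep [del m y u] in the [rs]-ball, where [dx_scale]
   applies; [2^-1] keeps [z] within [A] of the fixed point. *)
pose r := Num.min 2^-1 (Num.min rl (Num.min (rs / 2) (Num.min r1 (t / 4)))).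
have [rh rrl rrs rr1 rt] :
    [/\ r <= 2^-1, r <= rl, r <= rs / 2, r <= r1 & r <= t / 4].
  by rewrite /r; split; rewrite !ge_min lexx ?orbT.
have r0 : 0 < r by rewrite !lt_min rl0 rs2 r10; lra.
have A1 := radius_gt1.
have [T T0 lowT] := mdist_small cK r0.
(* The orbits must stay in the [dx x]-ball of radius [T / 2], which lies in the [r]-ball. The
   composite [f] preserves it: [dx x x (f x) <= 2 * tau <= (1 - a) * T / 2], and [f] multiplies
   [dx x] by at most [a]. *)
pose tau := Num.min (T / 2) ((1 - a) * T / 4).
have tau0 : 0 < tau.
  by rewrite lt_min; apply/andP; split; rewrite !mulr_gt0// subr_gt0.
have [th th0 upT] := dx_small cK tau0.
have [C0 Cr Cth] : [/\ 0 < Num.min r (th / 2), Num.min r (th / 2) <= r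
    & Num.min r (th / 2) < th].
  rewrite lt_min r0 ge_min lexx gt_min.
  by split=> //; [lra | apply/orP; right; lra].
exists (Num.min r (th / 2)), r; split=> //.
move: (Num.min r (th / 2)) C0 Cr Cth => C C0 Cr Cth.
move=> x y [inK close] e m ea ma.
have Kx : K x by apply: inK; rewrite !inE eqxx.
have xyC : mdist x y <= C by apply: close; rewrite !inE eqxx ?orbT.
have xx : cball x r x by apply: cball_center; exact: ltW.
have xy : cball x r y by exact: le_trans Cr.
have e1 : nu e <= 1 by lra.
have m1 : nu m <= 1 by lra.
have e0 := nu_gt0 e; have m0 := nu_gt0 m.
have em : 0 <= nu e * nu m < 1.
  rewrite mulr_ge0 ?ltW//=; apply: le_lt_trans a1.
  by apply: le_trans ea; rewrite ler_piMr// ltW.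
have ema : nu e * nu m <= a by apply: le_trans ea; rewrite ler_piMr// ltW.
have inA u : cball x r u -> cball x A u by apply: cball_le; lra.
have ins u : cball x r u -> cball x rs u by apply: cball_le; lra.
have inl u : cball x r u -> cball x rl u by exact: cball_le.
have dil_ins u : cball x r u -> cball x rs (del m y u).
  move=> xu; have K'y : K' y by apply: (KK' x Kx); exact: cball_le xy.
  have yu : mdist y u < t by have := mdist_cball2 xy xu; lra.
  have := stab m y u m1 K'y yu; move: xy; rewrite /cball/=.
  by have := mdistD y x (del m y u); lra.
pose f u := del e x (del m y u).
have fA u : cball x r u -> cball x A (f u).
  by move=> /dil_ins xu; case: (scale x x _ _ e Kx (ins _ xx) xu xu e1).
have fscale u v : cball x r u -> cball x r v ->
    dx x (f u) (f v) = nu e * nu m * dx x u v.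
  move=> xu xv.
  have [_ ->] := scale x x _ _ e Kx (ins _ xx) (dil_ins u xu) (dil_ins v xv) e1.
  have [_ ->] := scale x y _ _ m Kx (ins _ xy) (ins u xu) (ins v xv) m1.
  by rewrite mulrA.
have dxy : dx x x y <= tau by apply: upT => //; [exact: inA | lra].
have [tau1 tau2] : tau <= T / 2 /\ tau <= (1 - a) * T / 4.
  by rewrite !ge_min !lexx orbT.
have dxfx : dx x x (f x) <= 2 * tau.
  (* Triangle inequality through [y], where [dx x y (del m y x)] equals [nu m * dx x y x]. *)
  have [_ Ex] := scale x x x _ e Kx (ins _ xx) (ins _ xx) (dil_ins x xx) e1.
  rewrite (A1_fix hA1) in Ex; rewrite [f x]/f Ex.
  have [yA Ey] := scale x y y x m Kx (ins _ xy) (ins _ xy) (ins _ xx) m1.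
  have [mA _] := scale x y x y m Kx (ins _ xy) (ins _ xx) (ins _ xy) m1.
  rewrite (A1_fix hA1) in Ey yA.
  have h := dx_triangle (cball_self x) yA mA.
  have ge := dx_ge0 (cball_self x) mA; have gy := dx_ge0 (cball_self x) yA.
  rewrite Ey (dxC yA (cball_self x)) in h.
  have : nu m * dx x x y <= dx x x y by rewrite ler_piMl.
  have : nu e * dx x x (del m y x) <= dx x x (del m y x) by rewrite ler_piMl.
  lra.
(* The first component makes the metric laws of [dx x] available; inside the [A]-ball, [lowT]
   recovers it from the second. *)
pose P u := cball x r u /\ dx x x u <= T / 2.
have fP u : P u -> P (f u).
  move=> [xu dxu].
  have fT : dx x x (f u) <= T / 2.
    have := dx_triangle (cball_self x) (fA _ xx) (fA _ xu).
    rewrite (fscale _ _ xx xu).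
    have : nu e * nu m * dx x x u <= a * (T / 2).
      apply: ler_pM => //; first by case/andP: em.
      exact: dx_ge0 (cball_self x) (inA _ xu).
    lra.
  by split=> //; apply: lowT (fA _ xu) _ => //; lra.
pose xs n := iter n f x; pose ys n := iter n f y.
have xsP n : P (xs n).
  elim: n => [|n /fP//]; split=> //.
  apply: le_trans tau1; apply: upT; rewrite ?mdistxx//.
  exact: cball_self.
have ysP n : P (ys n) by elim: n => [|n /fP//]; split=> //; lra.
have fE n z : cball x r z -> del e (xs n) (del m (ys n) z) = f z.
  (* Apply linearity twice, using ys n.+1 = del e (xs n) (ys n). *)
  elim: n z => // n IH z xz; have [xn _] := xsP n; have [yn _] := ysP n.
  have [yn1 _] := ysP n.+1.
  have step z' : cball x r z' -> f z' = del m (ys n.+1) (del e (xs n) z').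
    move=> xz'; rewrite -(IH _ xz').
    have [_ ->] := lin _ _ _ _ _ _ Kx (inl _ xn) (inl _ yn) (inl _ xz') e1 m1.
    by congr (del m _ _); rewrite /ys/= -/(ys n) -(IH _ yn) (A1_fix hA1).
  have -> : xs n.+1 = del m (ys n.+1) (xs n).
    by rewrite /xs/= -/(xs n) (step _ xn) (A1_fix hA1).
  rewrite (step _ xz).
  by have [_ ->] := lin _ _ _ _ _ _ Kx (inl _ yn1) (inl _ xn) (inl _ xz) m1 e1.
have dxn u v n : (forall n, P (iter n f u)) -> (forall n, P (iter n f v)) ->
    dx x (iter n f u) (iter n f v) = (nu e * nu m) ^+ n * dx x u v.
  move=> Pu Pv; elim: n => [|n IH]; first by rewrite expr0 mul1r.
  by rewrite !iterS (fscale _ _ (Pu n).1 (Pv n).1) IH exprS mulrA.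
have K'P u : P u -> K' u.
  by move=> [xu _]; apply: (KK' x Kx); exact: cball_le xu.
have [w [w' acc]] := compact_accumulation2 cK' (fun n => K'P _ (xsP n))
  (fun n => K'P _ (ysP n)).
have in_r p (ps : nat -> X) : (forall n, P (ps n)) ->
    (forall eta : R, 0 < eta -> exists n, mdist p (ps n) < eta) -> cball x r p.
  move=> psP h; apply/ler_addgt0Pr => eta /h[n hn].
  have [+ _] := psP n; rewrite /cball/=.
  by have := mdistD (ps n) x p; rewrite (mdistC (ps n) p); lra.
have xw : cball x r w.
  by apply: (in_r _ xs) => // eta /(acc _ 0)[n _ [? _]]; exists n.
have xw' : cball x r w'.
  by apply: (in_r _ ys) => // eta /(acc _ 0)[n _ [_ ?]]; exists n.
have near eta : 0 < eta -> exists n,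
    [/\ dx x w (xs n) <= eta, dx x w' (ys n) <= eta,
        dx x (xs n) (ys n) <= eta & dx x (xs n) (f (xs n)) <= eta].
  move=> eta0; have [t1 t10 h1] := dx_cont (inA _ xw) eta0.
  have [t2 t20 h2] := dx_cont (inA _ xw') eta0.
  have [N1 hN1] := geometric_lt (dx x x y) em eta0.
  have [N2 hN2] := geometric_lt (dx x x (f x)) em eta0.
  have t120 : 0 < Num.min t1 t2 by rewrite lt_min t10.
  have [n] := acc _ (maxn N1 N2) t120.
  rewrite geq_max !lt_min => /andP[n1 n2] [/andP[xw1 _] /andP[_ xw2]].
  exists n; have [xn _] := xsP n; have [yn _] := ysP n; split.
  - exact: h1 (inA _ xn) xw1.
  - exact: h2 (inA _ yn) xw2.
  - by rewrite dxn// ltW// hN1.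
  (* Seen as two orbits, started at [x] and at [f x], consecutive iterates also approach each other
     geometrically. *)
  have -> : f (xs n) = iter n f (f x) by rewrite -iterSr.
  by rewrite dxn// ?ltW ?hN2// => k; rewrite -iterSr; exact: (xsP k.+1).
(* The 3 counts the legs of the paths [w], [xs n], [ys n], [w'] and [w], [xs n], [f (xs n)],
   [f w]. *)
have dx0 u v : cball x A u -> cball x A v ->
    (forall eta, 0 < eta -> dx x u v <= 3 * eta) -> u = v.
  move=> xu xv h; apply: (hdx xu xv); apply/eqP.
  rewrite eq_le (dx_ge0 xu xv) andbT; apply/ler_addgt0Pr => eta eta0.
  have eta3 : 0 < eta / 3 by lra.
  by have := h _ eta3; lra.
have ww' : w = w'.
  apply: dx0; [exact: inA|exact: inA|move=> eta /near[n [h1 h2 h3 _]]].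
  have [xn _] := xsP n; have [yn _] := ysP n.
  have := dx_triangle (inA _ xw) (inA _ xn) (inA _ xw').
  have := dx_triangle (inA _ xn) (inA _ yn) (inA _ xw').
  by rewrite (dxC (inA _ yn) (inA _ xw')); lra.
subst w'.
have fw : f w = w.
  apply: esym; apply: dx0; [exact: inA|exact: fA|].
  move=> eta /near[n [h1 _ _ h4]]; have [xn _] := xsP n.
  have := dx_triangle (inA _ xw) (inA _ xn) (fA _ xw).
  have := dx_triangle (inA _ xn) (fA _ xn) (fA _ xw).
  rewrite (fscale _ _ xn xw) (dxC (inA _ xn) (inA _ xw)).
  have : nu e * nu m * dx x w (xs n) <= dx x w (xs n).
    apply: (ler_piMl (dx_ge0 (inA _ xw) (inA _ xn))).
    by case/andP: em => _ /ltW.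
  lra.
have dom p q z : cball x r p -> cball x r q -> cball x r z ->
    dil2_dom nu D e p m q z.
  move=> xp xq xz.
  by have [] := lin _ _ _ _ e m Kx (inl _ xp) (inl _ xq) (inl _ xz) e1 m1.
exists w; split=> //; first by split=> //; exact: dom.
  (* The [dx x]-distance of two fixed points is multiplied by a factor below 1, hence is 0. *)
  move=> v xv [_ fv]; apply: hdx (inA _ xv) (inA _ xw) _.
  have := fscale _ _ xv xw; rewrite fw [f v]fv => /eqP.
  rewrite -{1}[dx x v w]mul1r -subr_eq0 -mulrBl mulf_eq0 subr_eq0.
  by case/andP: em => _ em1; rewrite gt_eqF//= => /eqP.
move=> z [_ close3].
have xz : cball x r z.
  by apply: le_trans Cr; apply: close3; rewrite !inE eqxx ?orbT.
have wz : cball w A z by have := mdist_cball2 xw xz; rewrite /cball/=; lra.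
split; first exact: dom.
  rewrite dil_dom_small; first exact: cball_dilU.
  by rewrite nuD ltW//; case/andP: em.
rewrite -(dilD e1 m1 wz); apply: mdist_positivity; apply/eqP.
rewrite eq_le mdist_ge0 andbT; apply/ler_addgt0Pr => eta eta0; rewrite add0r.
(* Along the indices where [xs n] and [ys n] are close to [w], continuity of the inner dilatation
   (to within [t1]), then of the outer one, compares the constant value [f z] with
   [del e w (del m w z)]. *)
have [wzm wze] := dom w w z xw xw xz.
have [t1 t10 h1] := dil_near wze eta0.
have [t2 t20 h2] := dil_near wzm t10.
have t120 : 0 < Num.min t1 t2 by rewrite lt_min t10.
have [n _] := acc _ 0 t120; rewrite !lt_min => -[/andP[xn1 _] /andP[_ yn2]].
have [xn _] := xsP n; have [yn _] := ysP n.
have [dm de] := dom _ _ _ xn yn xz.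
rewrite mdistC -/(f z) -(fE n z xz) ltW//; apply: h1 => //.
by apply: h2 => //; rewrite mdistxx.
Qed.

End dilatation_structure.

Theorem theorem6p2 (R : realType) (G : topologicalZmodType) (nu : G -> R)
    (X : metricType R) (D : dilatations G X)
    (hG : hausdorff_space G)
    (hnu : scale_morphism nu)
    (hXcomplete : complete_space X)
    (hXlc : locally_compact [set: X])
    (hD : dilatation_structure nu D)
    (hlin : linear_dilatations nu D) :
  menelaos nu D.
Proof.
have [A [B [hA0 hA1 hA2 [dx [hA3 hdx]]]]] := hD.
exact: (linear_menelaos hnu hA0 hA1 hA2 hA3 hXlc hlin hdx).
Qed.
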